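(* Let $q$ be a prime power, let $n$ be a positive integer divisible by $q$, and let $T_{\frac{q-1}{q}n}\subseteq\mathbb{F}_q^n$ be the set of vectors of Hamming weight $\frac{q-1}{q}n$. If, for some odd $k\geq5$, a function $f:T_{\frac{q-1}{q}n}\to\mathbb{F}_q$ passes the $\mathbb{F}_q$-Test$_k$ with probability $\frac{1+(q-1)\delta}{q}$, then there exists $u\in\mathbb{F}_q^n$ such that \[ \Pr_{x\sim T_{\frac{q-1}{q}n}}\bigl[f(x)=u\cdot x\bigr]\;\geq\;\frac{1+(q-1)\delta}{q}-o(1). \]
   Context: The Hamming weight of $x\in\mathbb{F}_q^n$ is its number of nonzero coordinates; $u\cdot x=\sum_iu_ix_i\in\mathbb{F}_q$. For a set $S\subseteq\mathbb{F}_q^n$, the $\mathbb{F}_q$-Test$_k$ on $f:S\to\mathbb{F}_q$ samples $(a_1,\dots,a_k,x_1,\dots,x_k)$ uniformly from the set of tuples in $(\mathbb{F}_q^* )^k\times S^k$ with $a_1x_1+\cdots+a_kx_k=0$, and accepts iff $a_1f(x_1)+\cdots+a_kf(x_k)=0$. Here $S=T_{\frac{q-1}{q}n}$, and $x\sim T_{\frac{q-1}{q}n}$ means uniform. The $o(1)$ term depends only on $n,q,k$ (not on $f$) and tends to $0$ as $n\to\infty$. *)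

(* Defs.v *)
From mathcomp Require Import all_boot all_order all_algebra.
From mathcomp Require Import reals.

Set Implicit Arguments.
Unset Strict Implicit.
Unset Printing Implicit Defensive.

Import GRing.Theory Num.Theory.
Local Open Scope ring_scope.

(* Probability of E under the uniform distribution on A; it is 0 when A is
   empty, by the convention x / 0 = 0. *)
Definition unif_pr (R : realType) (T : finType) (A : {set T}) (E : pred T) : R :=
  #|[set x in A | E x]|%:R / #|A|%:R.

Definition hamming_weight (F : finFieldType) (n : nat) (x : 'rV[F]_n) : nat :=
  #|[set i : 'I_n | x 0 i != 0]|.

Definition dot (F : finFieldType) (n : nat) (u x : 'rV[F]_n) : F :=
  \sum_(i < n) u 0 i * x 0 i.

(* The natural-number division is exact when #|F| divides n. *)
Definition mid_slice (F : finFieldType) (n : nat) : {set 'rV[F]_n} :=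
  [set x | hamming_weight x == ((#|F| - 1) * n %/ #|F|)%N].

Definition elt (F : finFieldType) (n : nat) (S : {set 'rV[F]_n}) : finType :=
  {x : 'rV[F]_n | x \in S}.

Definition test_tuples (F : finFieldType) (n k : nat) (S : {set 'rV[F]_n}) :
    {set {ffun 'I_k -> F} * {ffun 'I_k -> elt S}} :=
  [set ax : {ffun 'I_k -> F} * {ffun 'I_k -> elt S} |
    [forall i, ax.1 i != 0] & \sum_(i < k) ax.1 i *: val (ax.2 i) == 0].

Definition test_accepts (F : finFieldType) (n k : nat) (S : {set 'rV[F]_n})
    (f : elt S -> F) : pred ({ffun 'I_k -> F} * {ffun 'I_k -> elt S}) :=
  fun ax => \sum_(i < k) ax.1 i * f (ax.2 i) == 0.

Definition test_pass_pr (R : realType) (F : finFieldType) (n k : nat)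
    (S : {set 'rV[F]_n}) (f : elt S -> F) : R :=
  unif_pr R (test_tuples k S) (test_accepts f).

(* Main.v *)
Require Import Defs.
From mathcomp Require Import all_boot all_order all_fingroup all_algebra.
From mathcomp Require Import all_field all_character.
From mathcomp Require Import all_classical all_reals all_analysis.
From mathcomp Require Import zify ring lra.

(**
  Write G(u) = q #{x in S : f x = u.x} - #|S|. Expanding powers of G(u) into
  additive characters shows that the pass probability of the k-query test is
  (1 + (q-1) delta) / q with delta = sum_u G(u)^k / sum_u g(u)^k, where g is G
  for f = 0. Since the test with k-1 queries passes with probability at most 1,
  sum_u G(u)^(k-1) <= sum_u g(u)^(k-1), whence
  delta <= (max G) * sum_u g(u)^(k-1) / sum_u g(u)^k  (k-1 is even).
  It remains to see that both moments of g are dominated by those u that vanish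
  on the slice, for which g(u) = g(0). On the slice, g(u) is a multiple of a
  Krawtchouk value K(j), j the weight of u. Because the slice is the middle one,
  K satisfies K(1) = 0 and a three-term recurrence which gives K(j) = O(K(0)/n)
  for all other u; as sum_u g(u)^2 <= (n+1) g(0)^2 (the middle slice is the
  largest one), the remaining fourth and higher moments are O(1/n).
*)

Set Implicit Arguments.
Unset Strict Implicit.
Unset Printing Implicit Defensive.

Import Order.TTheory GRing.Theory Num.Theory.
Import numFieldNormedType.Exports.
Local Open Scope ring_scope.

(** * Nontrivial additive characters of a finite field *)

Section AdditiveCharacter.

Variable F : finFieldType.

Definition additive_character (chi : F -> algC) : Prop :=
  [/\ chi 0 = 1, forall s t, chi (s + t) = chi s * chi t & \sum_t chi t = 0].

(** A finite abelian group has as many irreducible characters as elements, all of them linear, so a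
    nontrivial one exists. Translating its sum by a [t0] with ['chi_i t0 != 1] multiplies the sum by
    that value, hence the sum is 0. *)
Lemma additive_character_exists : exists chi, additive_character chi.
Proof.
pose G : {group F} := [set: F]%G.
have abG : abelian G by apply/centsP => x _ y _; exact: addrC.
have lin (i : Iirr G) : 'chi_i \is a linear_char by apply/char_abelianP.
have lt1N : (1 < Nirr G)%N.
  move: abG; rewrite card_classes_abelian NirrE => /eqP ->.
  by rewrite cardsT finNzRing_gt1.
pose i : Iirr G := Ordinal lt1N.
have chiM s t : 'chi_i (s + t) = 'chi_i s * 'chi_i t.
  by rewrite -(lin_charM (lin i)) ?inE.
exists 'chi_i; split => //; first exact: (lin_char1 (lin i)).
have [t0 t0P] : exists t0, 'chi_i t0 != 1.
  apply/existsP; rewrite -negb_forall; apply/negP => /forallP all1.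
  have : i == 0 by rewrite -irr_eq1; apply/eqP/cfun_inP => x xG;
    rewrite cfun1E xG; apply/eqP; apply: all1.
  by [].
set s := \sum_t _.
have : s = 'chi_i t0 * s.
  rewrite /s mulr_sumr (reindex_inj (addrI t0)) /=.
  by apply: eq_bigr => t _; rewrite chiM.
move/eqP; rewrite -subr_eq0 -{1}[s]mul1r -mulrBl mulf_eq0 subr_eq0 eq_sym.
by rewrite (negbTE t0P) => /eqP.
Qed.

End AdditiveCharacter.

(** * Sums over a set of vectors, dot products, and agreement with a functional *)

Lemma sum_elt (F : finFieldType) (n : nat) (S : {set 'rV[F]_n}) (V : nmodType)
    (g : 'rV[F]_n -> V) :
  \sum_(x : elt S) g (val x) = \sum_(x in S) g x.
Proof. by rewrite [RHS]big_sub. Qed.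

Lemma card_elt (F : finFieldType) (n : nat) (S : {set 'rV[F]_n}) :
  #|{: elt S}| = #|S|.
Proof. by rewrite card_sig; apply: eq_card. Qed.

Lemma dotC (F : finFieldType) (n : nat) (u x : 'rV[F]_n) : dot u x = dot x u.
Proof. by apply: eq_bigr => i _; rewrite mulrC. Qed.

Lemma dotZr (F : finFieldType) (n : nat) (a : F) (u x : 'rV[F]_n) :
  dot u (a *: x) = a * dot u x.
Proof. by rewrite /dot mulr_sumr; apply: eq_bigr => i _; rewrite mxE mulrCA. Qed.

Lemma dot_sumr (F : finFieldType) (n : nat) (I : finType) (u : 'rV[F]_n)
    (x : I -> 'rV[F]_n) : dot u (\sum_i x i) = \sum_i dot u (x i).
Proof.
rewrite /dot exchange_big; apply: eq_bigr => i _.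
by rewrite summxE mulr_sumr.
Qed.

Lemma big_rV_distr (F : finFieldType) (V : comPzSemiRingType) (n : nat)
    (g : 'I_n -> F -> V) :
  \sum_(x : 'rV[F]_n) \prod_i g i (x 0 i) = \prod_i \sum_t g i t.
Proof.
rewrite bigA_distr_bigA (reindex (fun h : {ffun 'I_n -> F} => \row_i h i)) /=.
  by apply: eq_bigr => h _; apply: eq_bigr => i _; rewrite mxE.
exists (fun x : 'rV[F]_n => [ffun i => x 0 i]) => [h _|x _].
  by apply/ffunP => i; rewrite ffunE mxE.
by apply/rowP => i; rewrite mxE ffunE.
Qed.

(* With [p] the probability that [f x = dot u x], this is [(q p - 1) * #|S|]. *)
Definition agreement (F : finFieldType) (n : nat) (S : {set 'rV[F]_n})
    (f : elt S -> F) (u : 'rV[F]_n) : int :=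
  (#|F| * #|[set x : elt S | f x == dot u (val x)]|)%:Z - #|S|%:Z.

(** * Orthogonality of characters and power moments of the agreement *)

Section CharacterSums.

Variables (F : finFieldType) (chi : F -> algC).
Hypothesis chiP : additive_character chi.

Let q := #|F|.
Let chi0 : chi 0 = 1. Proof. by case: chiP. Qed.
Let chiD s t : chi (s + t) = chi s * chi t. Proof. by case: chiP. Qed.

Lemma additive_character_sum (I : finType) (g : I -> F) :
  chi (\sum_i g i) = \prod_i chi (g i).
Proof. exact: (big_morph chi chiD chi0). Qed.

Lemma sum_additive_characterM t : \sum_a chi (a * t) = q%:R * (t == 0)%:R.
Proof.
have [->|t0] := eqVneq t 0.
  under eq_bigr do rewrite mulr0 chi0.
  by rewrite mulr1 sumr_const.
rewrite mulr0 (reindex_inj (mulIf (invr_neq0 t0))) /=.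
by under eq_bigr do rewrite mulfVK //; case: chiP.
Qed.

Lemma sum_additive_characterM_neq0 t :
  \sum_(a | a != 0) chi (a * t) = q%:R * (t == 0)%:R - 1.
Proof.
by rewrite -sum_additive_characterM [in RHS](bigD1 0) //= mul0r chi0 addrC addrK.
Qed.

Lemma sum_additive_character_dot (n : nat) (x : 'rV[F]_n) :
  \sum_u chi (dot u x) = (q ^ n)%:R * (x == 0)%:R.
Proof.
under eq_bigr do rewrite additive_character_sum.
rewrite (big_rV_distr (fun i t => chi (t * x 0 i))).
under eq_bigr do rewrite sum_additive_characterM.
rewrite big_split /= prodr_const card_ord -natrX; congr (_ * _).
have [->|x0] := eqVneq x 0.
  by rewrite big1 // => i _; rewrite mxE eqxx.
have /existsP[i xi] : [exists i, x 0 i != 0].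
  rewrite -negb_forall; apply: contra x0 => /forallP x0.
  by apply/eqP/rowP => i; rewrite mxE; apply/eqP.
by rewrite (bigD1 i) //= (negbTE xi) mul0r.
Qed.

(** By orthogonality the inner sum is [q - 1] where [f x = dot u (val x)] and [-1] elsewhere. *)
Lemma agreement_character (n : nat) (S : {set 'rV[F]_n}) (f : elt S -> F) u :
  (agreement f u)%:~R =
    \sum_(x : elt S) \sum_(a | a != 0) chi (a * (f x - dot u (val x))).
Proof.
under eq_bigr do rewrite sum_additive_characterM_neq0 subr_eq0.
rewrite sumrB sumr_const card_elt -mulr_sumr -natr_sum /agreement rmorphB /=.
rewrite PoszM rmorphM; congr (_ * _%:R - _).
by rewrite -sum1_card -big_mkcond; apply: eq_bigl => x; rewrite inE.
Qed.

End CharacterSums.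

(* Expanding the k-th power into characters and summing over [u] leaves the
   tuples with [\sum_i a_i x_i = 0], each weighted by [chi (\sum_i a_i f(x_i))];
   rescaling [a] averages the latter over the nonzero multiples of its
   argument. *)
Lemma sum_agreement_exp (F : finFieldType) (n k : nat) (S : {set 'rV[F]_n})
    (f : elt S -> F) :
  (#|F| - 1)%:Z * \sum_u agreement f u ^+ k =
  (#|F| ^ n)%:Z * ((#|F| * #|[set ax in test_tuples k S | test_accepts f ax]|)%:Z
                   - #|test_tuples k S|%:Z).
Proof.
have [chi chiP] := additive_character_exists F.
have [chi0 chiD _] := chiP.
(* The integer identity is checked in [algC], where the characters take their values. *)
apply: (@intr_inj algC).
pose T := test_tuples k S.
pose sf (ax : {ffun 'I_k -> F} * {ffun 'I_k -> elt S}) :=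
  \sum_(i < k) ax.1 i * f (ax.2 i).
have E1 : (\sum_u agreement f u ^+ k)%:~R =
    (#|F| ^ n)%:R * \sum_(ax in T) chi (sf ax).
  rewrite rmorph_sum /=.
  under eq_bigr => u _.
    rewrite rmorphXn /= (agreement_character chiP) exchange_big /=.
    rewrite -[k in _ ^+ k]card_ord -prodr_const.
    rewrite bigA_distr_big /=.
    under eq_bigr => a _ do rewrite bigA_distr_bigA /=.
    rewrite pair_big /=.
    over.
  rewrite exchange_big /= mulr_sumr big_mkcond [RHS]big_mkcond /=.
  apply: eq_bigr => -[a x] _ /=; rewrite andbT.
  rewrite (_ : (a \in _) = [forall i, a i != 0]); last exact: eq_forallb.
  rewrite [in RHS]inE /=.
  case: ifP => //= _.
  set z := \sum_i a i *: _.
  have E (u : 'rV_n) : \prod_i chi (a i * (f (x i) - dot u (val (x i)))) =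
      chi (sf (a, x)) * chi (dot u (- z)).
    rewrite -(additive_character_sum chiP) -chiD; congr chi.
    under eq_bigr do rewrite mulrBr.
    rewrite sumrB -scaleN1r dotZr mulN1r dot_sumr; congr (_ - _).
    by apply: eq_bigr => i _; rewrite dotZr.
  under eq_bigr do rewrite E.
  rewrite -mulr_sumr (sum_additive_character_dot chiP) oppr_eq0 mulrCA.
  by case: (z == 0); rewrite ?mulr1 ?mulr0.
rewrite !rmorphM /= rmorphB /= E1 mulrCA; congr (_ * _).
have -> : (#|F| * #|[set ax in T | test_accepts f ax]|)%:~R - #|T|%:~R =
    \sum_(ax in T) \sum_(b | b != 0) chi (b * sf ax).
  under [RHS]eq_bigr do rewrite (sum_additive_characterM_neq0 chiP).
  rewrite sumrB sumr_const -mulr_sumr -natr_sum PoszM rmorphM.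
  congr (_ * _%:R - _); rewrite -sum1_card -big_mkcondr /=.
  by apply: eq_bigl => ax; rewrite inE.
rewrite exchange_big /=.
rewrite [RHS](eq_bigr (fun=> \sum_(ax in T) chi (sf ax))) => [|b b0].
  by rewrite sumr_const -[RHS]mulr_natl subn1 -(cardC1 (0 : F)).
have ib0 : b^-1 != 0 by rewrite invr_neq0.
pose h c (ax : {ffun 'I_k -> F} * {ffun 'I_k -> elt S}) :=
  ([ffun i => c * ax.1 i], ax.2).
have hK c d : c * d = 1 -> cancel (h c) (h d).
  move=> cd [a x]; congr pair; apply/ffunP => i.
  by rewrite !ffunE mulrA (mulrC d) cd mul1r.
rewrite (reindex (h b^-1)) /=; last first.
  by exists (h b) => ax _; apply: hK; rewrite ?mulVf ?mulfV.
apply: eq_big => ax => [|_].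
  rewrite !inE /=; congr (_ && _).
    by apply: eq_forallb => i; rewrite ffunE mulf_eq0 (negbTE ib0).
  have -> : \sum_i [ffun i => b^-1 * ax.1 i] i *: val (ax.2 i) =
      b^-1 *: \sum_i ax.1 i *: val (ax.2 i).
    by rewrite scaler_sumr; apply: eq_bigr => i _; rewrite ffunE scalerA.
  by rewrite scaler_eq0 (negbTE ib0).
congr chi; rewrite mulr_sumr; apply: eq_bigr => i _.
by rewrite ffunE !mulrA mulfV // mul1r.
Qed.

(** * Krawtchouk values at the middle weight: recurrence and decay *)

(** Generating function of the Krawtchouk values [K_w(j)], with [w] as the exponent. The ring is
    general because the values are integers while the character sums they describe live in
    [algC]. *)
Definition kraw_poly (R : comNzRingType) (q n j : nat) : {poly R} :=
  (1 - 'X) ^+ j * (1 + (q%:R - 1) * 'X) ^+ (n - j).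

(* The value at [j] of the Krawtchouk polynomial [K_w]. *)
Definition kraw (q n w j : nat) : int := (kraw_poly int q n j)`_w.

Lemma map_kraw_poly (R : comNzRingType) (q n j : nat) :
  map_poly (intr : int -> R) (kraw_poly int q n j) = kraw_poly R q n j.
Proof.
rewrite /kraw_poly rmorphM !rmorphXn /= rmorphB rmorphD rmorphM rmorphB /=.
by rewrite map_polyX rmorph1 rmorph_nat.
Qed.

(* [q 'X] is the difference of the two linear factors, so [q 'X P'] is again a
   combination of neighbouring polynomials of the family. *)
Lemma deriv_kraw_poly (R : comNzRingType) (q n j : nat) : (j <= n)%N ->
  q%:R * ('X * (kraw_poly R q n j)^`()) =
  - j%:R * kraw_poly R q n j.-1
  + (j%:R + (q%:R - 1) * (n - j)%:R) * kraw_poly R q n j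
  - (q%:R - 1) * (n - j)%:R * kraw_poly R q n j.+1.
Proof.
move=> jn; rewrite /kraw_poly.
have dA : (1 + (q%:R - 1) * 'X : {poly R})^`() = q%:R - 1.
  rewrite derivD derivM derivX derivB -!polyC1 -polyC_natr !derivC.
  by rewrite subr0 mul0r !add0r mulr1.
have dB : (1 - 'X : {poly R})^`() = -1.
  by rewrite derivB -polyC1 derivC derivX sub0r.
rewrite derivM !deriv_exp dA dB.
set A := 1 + (q%:R - 1) * 'X; set B := 1 - 'X.
have EX : q%:R * 'X = A - B by rewrite /A /B; ring.
rewrite mulrA EX -!(mulr_natr (_ * _)).
have [i ->] : exists i, n = (j + i)%N by exists (n - j)%N; lia.
rewrite addKn; case: j {jn} => [|j] /=; case: i => [|i] /=.
- by rewrite !expr0; ring.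
- by rewrite subn0 add0n subn1 /= !exprS expr0; ring.
- by rewrite addn0 subSnn (_ : j.+1 - j.+2 = 0)%N ?exprS ?expr0; [ring|lia].
have -> : (j.+1 + i.+1 - j = i.+2)%N by lia.
have -> : (j.+1 + i.+1 - j.+2 = i)%N by lia.
rewrite !exprS; ring.
Qed.

(** Compare coefficients of ['X^w] in [deriv_kraw_poly]. The diagonal term carries
    [q w - j - (q - 1)(n - j)], which the middle weight collapses to [(q - 2) j]; so the whole right
    side vanishes at [j = 0]. *)
Lemma kraw_rec (q n w j : nat) : (j <= n)%N -> (q * w = (q - 1) * n)%N ->
  (0 < q)%N ->
  (q%:Z - 1) * (n - j)%:Z * kraw q n w j.+1 =
  - j%:Z * kraw q n w j.-1 - (q%:Z - 2) * j%:Z * kraw q n w j.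
Proof.
move=> jn qw q0; have /(congr1 (fun p : {poly int} => p`_w)) := deriv_kraw_poly int q jn.
have cM (m : nat) (p : {poly int}) : (m%:R * p)`_w = m%:R * p`_w.
  by rewrite mulr_natl coefMn mulr_natl.
have -> : (q%:R * ('X * (kraw_poly int q n j)^`()))`_w =
    (q * w)%:R * kraw q n w j.
  rewrite cM coefXM coef_deriv natrM -mulrA /kraw; congr (_ * _).
  by case: (w) => [|v] /=; rewrite ?mul0r // mulr_natl.
have -> : - j%:R * kraw_poly int q n j.-1
    + (j%:R + (q%:R - 1) * (n - j)%:R) * kraw_poly int q n j
    - (q%:R - 1) * (n - j)%:R * kraw_poly int q n j.+1 =
    (j + (q - 1) * (n - j))%:R * kraw_poly int q n j
    - j%:R * kraw_poly int q n j.-1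
    - ((q - 1) * (n - j))%:R * kraw_poly int q n j.+1.
  by rewrite natrD natrM !natrB //; ring.
rewrite !coefB !cM -/(kraw _ _ _ _) => E.
rewrite qw natrD !natrM !natrB // in E.
apply/eqP; rewrite -subr_eq0 -subzn // -!natz; apply/eqP.
move/eqP: E; rewrite -subr_eq0 => /eqP <-; ring.
Qed.

(* The recurrence has [j <= n - j] in the range considered, so it cannot
   increase the larger of two consecutive absolute values. *)
Lemma kraw_rec_bound (q n : nat) (K : nat -> int) :
  (1 < q)%N -> (1 < n)%N ->
  (forall j, (j < n)%N -> (q%:Z - 1) * (n - j)%:Z * K j.+1 =
     - j%:Z * K j.-1 - (q%:Z - 2) * j%:Z * K j) ->
  forall j, (0 < j)%N -> (j.*2 <= n.+2)%N -> (n%:Z - 1) * `|K j| <= `|K 0|.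
Proof.
move=> q1 n1 rec.
have K1 : K 1%N = 0.
  have := rec 0%N (ltnW n1); rewrite subn0 !mulr0 !mul0r oppr0 addr0.
  by move/eqP; rewrite !mulf_eq0; lia.
(* The bound is not claimed at index 0, so the induction carries two consecutive values with a guard
   on the earlier one. *)
suff H j : (j.*2 <= n)%N -> (n%:Z - 1) * `|K j.+1| <= `|K 0| /\
    ((0 < j)%N -> (n%:Z - 1) * `|K j| <= `|K 0|).
  by case=> // j _ jn; apply: (H j _).1; lia.
elim: j => [|j IH] jn; first by rewrite K1 normr0 mulr0.
have [IH1 IH2] : (n%:Z - 1) * `|K j.+1| <= `|K 0| /\
    ((0 < j)%N -> (n%:Z - 1) * `|K j| <= `|K 0|) by apply: IH; lia.
split => // {IH}.
have jn' : (j.+1 < n)%N by lia.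
have := rec _ jn'; rewrite -subzn 1?ltnW //= => E.
have : (q%:Z - 1) * (n%:Z - j.+1%:Z) * `|K j.+2| <=
    j.+1%:Z * `|K j| + (q%:Z - 2) * j.+1%:Z * `|K j.+1|.
  have q1' : 0 <= q%:Z - 1 by lia.
  have nj : 0 <= n%:Z - j.+1%:Z by lia.
  have q2' : 0 <= q%:Z - 2 by lia.
  rewrite -[X in X * `|K j.+2|]ger0_norm ?mulr_ge0 // -normrM E.
  rewrite (le_trans (ler_normB _ _)) // !normrM normrN.
  by rewrite (ger0_norm q2').
(* The factor [n - 1] is born at [j = 0]: as [K 1 = 0], only [K 0] feeds [K 2], whose coefficient is
   [(q - 1)(n - 1)]. Later steps merely preserve it. *)
have [->|j0] := posnP j.
  rewrite K1 normr0 mulr0 addr0 mul1r => H.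
  have : (q%:Z - 1) * ((n%:Z - 1) * `|K 2|) <= 1 * `|K 0|.
    by rewrite mul1r; apply: le_trans H; rewrite mulrA.
  move: (normr_ge0 (K 2)) (normr_ge0 (K 0%N)); move: `|K 2| `|K 0%N| => x y.
  move=> x0 y0 H1.
  have : 1 * ((n%:Z - 1) * x) <= (q%:Z - 1) * ((n%:Z - 1) * x).
    by rewrite ler_wpM2r ?mulr_ge0 //; lia.
  by move=> H2; rewrite mul1r in H2; apply: le_trans H2 _; rewrite mul1r in H1.
move: IH1 (IH2 j0) (normr_ge0 (K j.+2)) (normr_ge0 (K 0%N)) => {IH2}.
move: `|K j| `|K j.+1| `|K j.+2| `|K 0%N| => a b x y Hb Ha x0 y0 H.
have nj : 0 < n%:Z - j.+1%:Z by lia.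
have q1' : 0 < q%:Z - 1 by lia.
have n1' : 0 <= n%:Z - 1 by lia.
rewrite -(ler_pM2l (mulr_gt0 q1' nj)).
have le1 := ler_wpM2l n1' H.
have le2 : j.+1%:Z * ((n%:Z - 1) * a) <= j.+1%:Z * y by rewrite ler_wpM2l.
have le3 : (q%:Z - 2) * j.+1%:Z * ((n%:Z - 1) * b) <= (q%:Z - 2) * j.+1%:Z * y.
  by rewrite ler_wpM2l // mulr_ge0 //; lia.
have le4 : (q%:Z - 1) * j.+1%:Z * y <= (q%:Z - 1) * (n%:Z - j.+1%:Z) * y.
  by rewrite ler_wpM2r // ler_wpM2l //; lia.
apply: le_trans le4; apply: le_trans (le_trans _ (lerD le2 le3)) _; last by lra.
by apply: le_trans (le_trans _ le1) _; lra.
Qed.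

Lemma coef_exp1DX (R : comNzRingType) (c : R) (n w : nat) :
  ((1 + c *: 'X) ^+ n)`_w = c ^+ w * 'C(n, w)%:R.
Proof.
rewrite exprDn.
under eq_bigr => i _ do rewrite expr1n mul1r exprZn -scaler_nat scalerA.
rewrite -(poly_def _ (fun i => 'C(n, i)%:R * c ^+ i)) coef_poly ltnS mulrC.
by case: leqP => // nw; rewrite bin_small // mulr0.
Qed.

Lemma kraw0 (q n w : nat) : (0 < q)%N ->
  kraw q n w 0 = ('C(n, w) * (q - 1) ^ w)%:Z.
Proof.
move=> q0; rewrite /kraw /kraw_poly expr0 mul1r subn0.
rewrite -polyC1 -polyC_natr -polyCB mul_polyC polyC1 coef_exp1DX.
rewrite (_ : q%:R - 1 = (q - 1)%:R); last by rewrite natrB.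
by rewrite -natrX -natrM natz mulnC.
Qed.

Lemma krawn (q n w : nat) : kraw q n w n = (- 1) ^+ w * 'C(n, w)%:Z.
Proof.
rewrite /kraw /kraw_poly subnn expr0 mulr1 -[- 'X]scaleN1r coef_exp1DX.
by rewrite natz.
Qed.

(** The recurrence is run downwards from [j = n], where the absolute value is ['C(n, w)]. As long as
    [n - j <= j], the two terms on the right combine to a loss of at most [1 + (q - 2) = q - 1] per
    step. *)
Lemma kraw_top_bound (q n w i : nat) :
  (1 < q)%N -> (i <= n)%N -> (i.*2 <= n.+2)%N -> (q * w = (q - 1) * n)%N ->
  `|kraw q n w (n - i)| <= ((q - 1) ^ i * 'C(n, w))%:Z.
Proof.
move=> q1 i_n i2 qw.
suff H : forall i, (i < n)%N -> (i.*2 <= n)%N ->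
    `|kraw q n w (n - i)| <= ((q - 1) ^ i * 'C(n, w))%:Z /\
    `|kraw q n w (n - i.+1)| <= ((q - 1) ^ i.+1 * 'C(n, w))%:Z.
  case: i i_n i2 => [|i] i_n i2; last by apply: (H i _ _).2; lia.
  rewrite subn0 krawn normrM normrX normrN1 expr1n mul1r expn0 mul1n.
  by rewrite ger0_norm.
have q1' : 1%:Z <= q%:Z - 1 by lia.
set c := 'C(n, w).
have step j : (0 < j <= n)%N -> j%:Z * `|kraw q n w j.-1| <=
    (q%:Z - 1) * (n - j)%:Z * `|kraw q n w j.+1|
    + (q%:Z - 2) * j%:Z * `|kraw q n w j|.
  move=> /andP[j0 jn].
  have -> : j%:Z * `|kraw q n w j.-1| = `|- j%:Z * kraw q n w j.-1|.
    by rewrite normrM normrN.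
  have /eqP := kraw_rec jn qw (ltnW q1); rewrite -subr_eq opprK => /eqP <-.
  rewrite (le_trans (ler_normD _ _)) // !normrM.
  by rewrite (ger0_norm (_ : 0 <= q%:Z - 2)) ?(ger0_norm (_ : 0 <= q%:Z - 1)) //; lia.
elim=> [|k IH] kn k2.
  have Kn : `|kraw q n w n| = c%:Z.
    by rewrite krawn normrM normrX normrN1 expr1n mul1r ger0_norm.
  rewrite subn0 Kn expn0 mul1n expn1 subn1; split=> //.
  have n0 : (0 < n <= n)%N by lia.
  have := step n n0; rewrite subnn mulr0 mul0r add0r Kn.
  rewrite [_ * n%:Z]mulrC -mulrA ler_pM2l; last by lia.
  by move=> H; apply: le_trans H _; rewrite PoszM -subzn ?ler_wpM2r //; lia.
have [IH1 IH2] : `|kraw q n w (n - k)| <= ((q - 1) ^ k * c)%:Z /\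
    `|kraw q n w (n - k.+1)| <= ((q - 1) ^ k.+1 * c)%:Z by apply: IH; lia.
split=> //; set j := (n - k.+1)%N in IH2 *.
have jb : (0 < j <= n)%N by lia.
have := step j jb.
have -> : j.-1 = (n - k.+2)%N by lia.
have -> : j.+1 = (n - k)%N by lia.
have -> : (n - j = k.+1)%N by lia.
move: IH1 IH2; rewrite !expnS -!mulnA !PoszM.
have -> : (q - 1)%N%:Z = q%:Z - 1 by lia.
set M := _ * c%:Z; move: `|_| `|_| `|_| => z y x Hx Hy.
have M0 : 0 <= M by [].
have j0 : 0 < j%:Z by lia.
move=> H; rewrite -(ler_pM2l j0); apply: le_trans H _.
have le1 : (q%:Z - 1) * k.+1%:Z * x <= (q%:Z - 1) * k.+1%:Z * M.
  by rewrite ler_wpM2l // mulr_ge0 //; lia.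
have le2 : (q%:Z - 2) * j%:Z * y <= (q%:Z - 2) * j%:Z * ((q%:Z - 1) * M).
  by rewrite ler_wpM2l // mulr_ge0 //; lia.
have le3 : (q%:Z - 1) * k.+1%:Z * M <= (q%:Z - 1) * j%:Z * M.
  by rewrite ler_wpM2r // ler_wpM2l //; lia.
apply: le_trans (lerD (le_trans le1 le3) le2) _.
by rewrite le_eqVlt; apply/orP; left; apply/eqP; ring.
Qed.

Lemma leq_sqr_exp2 m : (m ^ 2 <= 2 * 2 ^ m)%N.
Proof.
elim: m => // m IH; have [|m3] := leqP m 3; first by case: m {IH} => [|[|[|[|]]]].
rewrite -!mulnn (expnS 2) in IH *; nia.
Qed.

(** The lower half of the range follows from [kraw_rec_bound]. In the upper half, [q = 2] is handled
    by the symmetry [j -> n - j], and for [q > 2] the values are exponentially smaller than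
    [kraw q n w 0]. The excluded pair [q = 2], [j = n] has the same absolute value as [j = 0]. *)
Lemma kraw_bound (q m j : nat) : (1 < q)%N -> (0 < m)%N ->
  let n := (q * m)%N in let w := ((q - 1) * m)%N in
  (0 < j <= n)%N -> (2 < q)%N || (j < n)%N ->
  n%:Z ^+ 2 * kraw q n w j ^+ 2 <= 2%:Z * q%:Z ^+ 2 * kraw q n w 0 ^+ 2.
Proof.
move=> q1 m0 n w /andP[j0 jn] qj.
have qw : (q * w = (q - 1) * n)%N by rewrite /w /n; ring.
have n1 : (1 < n)%N by rewrite /n; nia.
(* Replacing [n - 1] by [n] costs a factor 2, hence 4 after squaring, and [4 <= 2 q^2]. *)
have small (K : int) : (n%:Z - 1) * `|K| <= `|kraw q n w 0| ->
    n%:Z ^+ 2 * K ^+ 2 <= 2%:Z * q%:Z ^+ 2 * kraw q n w 0 ^+ 2.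
  have sqN (z : int) : z ^+ 2 = `|z| ^+ 2 by rewrite real_normK ?num_real.
  rewrite (sqN K) (sqN (kraw q n w 0)).
  move: (normr_ge0 K); move: `|K| `|kraw q n w 0| => x y x0 H.
  have h1 : n%:Z * x <= 2%:Z * ((n%:Z - 1) * x).
    by rewrite mulrA ler_wpM2r //; lia.
  have h2 : n%:Z * x <= 2%:Z * y by apply: le_trans h1 _; rewrite ler_wpM2l.
  have y0 : 0 <= y by apply: le_trans H; rewrite mulr_ge0 //; lia.
  have h3 : (n%:Z * x) ^+ 2 <= (2%:Z * y) ^+ 2 by rewrite lerXn2r ?nnegrE ?mulr_ge0.
  rewrite exprMn in h3; apply: le_trans h3 _; rewrite exprMn ler_wpM2r ?sqr_ge0 //.
  by nia.
have [j2|j2] := leqP j.*2 n.+2.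
  apply/small/(kraw_rec_bound q1 n1) => // i i_n.
  exact: kraw_rec (ltnW i_n) qw (ltnW q1).
have [q2|q2] := leqP q 2.
  have jn' : (j < n)%N by case/orP: qj => //; lia.
  have q2E : q = 2%N by lia.
  (* For [q = 2] the middle term of the recurrence disappears, and the reversed sequence satisfies
     the same recurrence. *)
  pose L i := kraw q n w (n - i).
  have L0 : `|L 0| = `|kraw q n w 0|.
    rewrite /L subn0 krawn kraw0 1?ltnW // normrM normrX normrN1 expr1n mul1r.
    by rewrite q2E exp1n muln1.
  have -> : kraw q n w j = L (n - j)%N by rewrite /L subKn.
  apply: small; rewrite -L0; apply: (@kraw_rec_bound q n L) => //; try lia.
  move=> i i_n; have ni : (n - i <= n)%N by lia.
  have := kraw_rec ni qw (ltnW q1).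
  have -> : q%:Z - 1 = 1 by lia.
  have -> : q%:Z - 2 = 0 by lia.
  rewrite /L !mul0r !mul1r subr0 subKn 1?ltnW //.
  have -> : ((n - i).-1 = n - i.+1)%N by lia.
  case: i {ni} i_n => [|i] i_n /=.
    by rewrite !mul0r subr0 mulNr => E; apply: oppr_inj; rewrite -E.
  have -> : ((n - i.+1).+1 = n - i)%N by lia.
  by rewrite mulNr => E; rewrite subr0 mulNr E opprK.
have := @kraw_top_bound q n w (n - j) q1 (leq_subr _ _); rewrite subKn //.
have -> : ((n - j).*2 <= n.+2)%N by lia.
move=> /(_ isT qw); rewrite kraw0 1?ltnW //.
move: ('C(n, w)) => c Hj.
have -> : kraw q n w j ^+ 2 = `|kraw q n w j| ^+ 2 by rewrite real_normK ?num_real.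
have H2 : `|kraw q n w j| ^+ 2 <= ((q - 1) ^ (n - j) * c)%N%:Z ^+ 2.
  by rewrite lerXn2r ?nnegrE.
apply: le_trans (ler_wpM2l _ H2) _; first by rewrite sqr_ge0.
rewrite -!natz -!natrX -!natrM ler_nat.
have e1 (a b x y : nat) : ((a * b) ^ 2 * (x * y) ^ 2 =
    a ^ 2 * y ^ 2 * (b ^ 2 * x ^ 2))%N by ring.
have e2 (a x y : nat) : (2 * a ^ 2 * (x * y) ^ 2 =
    a ^ 2 * x ^ 2 * (2 * y ^ 2))%N by ring.
rewrite [in X in (X ^ 2 * _)%N]/n e1 e2 leq_mul2l; apply/orP; right.
(* This uses [q >= 3]. It leaves a surplus of at least [(q - 1)^m >= 2^m] in the square of
   [kraw q n w 0], which absorbs the [m^2] of [n^2 = q^2 m^2]; this gives the constant [2 q^2]. *)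
have w2n : (n + m <= w * 2)%N.
  by rewrite /n /w -mulSnr -[in X in (_ <= X)%N]mulnAC leq_mul2r; lia.
have -> : (((q - 1) ^ w) ^ 2 = (q - 1) ^ (w * 2 - n) * (q - 1) ^ n)%N.
  by rewrite -expnM -expnD subnK //; lia.
rewrite mulnA -expnM; apply: leq_mul; last first.
  by rewrite leq_pexp2l //; lia.
apply: leq_trans (leq_sqr_exp2 m) _; rewrite leq_mul2l /=.
apply: (@leq_trans ((q - 1) ^ m)); first by rewrite leq_exp2r //; lia.
by rewrite leq_pexp2l //; lia.
Qed.

(** The right-hand term is the largest of the [n + 1] terms in the expansion of [(1 + (q - 1))^n]:
    the ratio of consecutive terms, [(n - i)(q - 1) / (i + 1)], crosses 1 at [w]. *)
Lemma binomial_mode (q m : nat) : (0 < q)%N ->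
  let n := (q * m)%N in let w := ((q - 1) * m)%N in
  (q ^ n <= n.+1 * ('C(n, w) * (q - 1) ^ w))%N.
Proof.
move=> q0 /=; set n := (q * m)%N; set w := ((q - 1) * m)%N.
pose t i := ('C(n, i) * (q - 1) ^ i)%N.
have tS i : (t i.+1 * i.+1 = t i * ((n - i) * (q - 1)))%N.
  by rewrite /t expnS mulnAC [('C(_, _) * i.+1)%N]mulnC mul_bin_left; ring.
have nE : n = (w + m)%N by rewrite /n /w -mulSnr; congr (_ * _)%N; lia.
have up d : (d <= w -> t (w - d) <= t w)%N.
  elim: d => [|d IH] dw; first by rewrite subn0.
  apply: leq_trans (IH (ltnW dw)).
  have -> : (w - d = (w - d.+1).+1)%N by lia.
  rewrite -(leq_pmul2r (ltn0Sn (w - d.+1))) tS leq_mul2l; apply/orP; right.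
  apply: (@leq_trans w); first by lia.
  by rewrite /w mulnC leq_mul2r; lia.
have down d : (t (w + d) <= t w)%N.
  elim: d => [|d IH]; first by rewrite addn0.
  apply: leq_trans IH; rewrite addnS.
  rewrite -(leq_pmul2r (ltn0Sn (w + d))) tS leq_mul2l; apply/orP; right.
  apply: (@leq_trans w); last by lia.
  by rewrite /w mulnC leq_mul2l; lia.
have tw i : (t i <= t w)%N.
  have [iw|wi] := leqP i w; first by rewrite -(subKn iw) up // leq_subr.
  by rewrite -(subnKC (ltnW wi)).
rewrite -[q in (q ^ n)%N](@subnKC 1) // expnDn.
apply: (@leq_trans (\sum_(i < n.+1) t w)); last by rewrite sum_nat_const card_ord.
by apply: leq_sum => i _; rewrite exp1n mul1n; exact: tw.
Qed.

(** * Hamming weight and the Fourier transform of a slice *)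

Lemma hamming_weight0 (F : finFieldType) (n : nat) :
  hamming_weight (0 : 'rV[F]_n) = 0%N.
Proof. by apply/eqP; rewrite cards_eq0; apply/eqP/setP => i; rewrite !inE mxE eqxx. Qed.

Lemma hamming_weight_le (F : finFieldType) (n : nat) (u : 'rV[F]_n) :
  (hamming_weight u <= n)%N.
Proof. by rewrite -[X in (_ <= X)%N]card_ord max_card. Qed.

Lemma hamming_weightZ (F : finFieldType) (n : nat) (c : F) (u : 'rV[F]_n) :
  c != 0 -> hamming_weight (c *: u) = hamming_weight u.
Proof.
move=> c0; apply: eq_card => i; rewrite !inE mxE mulf_eq0.
by rewrite (negbTE c0).
Qed.

Section SliceTransform.

Variables (F : finFieldType) (n w : nat).
Let q := #|F|.
Let S : {set 'rV[F]_n} := [set x | hamming_weight x == w].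

(** Marking each nonzero coordinate of [x] by ['X] makes the sum over all vectors factor by
    coordinates: [1 - 'X] where [v] is nonzero, [1 + (q - 1) 'X] where it is zero. The coefficient
    of ['X^w] selects the slice. *)
Lemma sum_slice_character (chi : F -> algC) (v : 'rV[F]_n) :
  additive_character chi ->
  \sum_(x in S) chi (dot v x) = (kraw q n w (hamming_weight v))%:~R.
Proof.
move=> chiP; have [chi0 chiD _] := chiP.
pose g i t := chi (v 0 i * t) *: 'X^(t != 0).
have gE i : \sum_t g i t =
    if v 0 i != 0 then 1 - 'X else 1 + (q%:R - 1) * 'X.
  rewrite (bigD1 0) //= /g mulr0 chi0 eqxx scale1r expr0.
  under eq_bigr => t t0 do rewrite t0 mulrC.
  rewrite -scaler_suml; case: eqVneq => [->|vi] /=.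
    under eq_bigr do rewrite mulr0 chi0.
    rewrite sumr_const cardC1 -mul_polyC -subn1 natrB ?finNzRing_gt1 //; last first.
      by apply: ltnW; exact: finNzRing_gt1.
    by rewrite polyCB polyC_natr.
  rewrite (sum_additive_characterM_neq0 chiP) (negbTE vi) mulr0 sub0r.
  by rewrite scaleN1r.
transitivity ((\sum_(x : 'rV[F]_n) \prod_i g i (x 0 i))`_w).
  rewrite coef_sum big_mkcond /=; apply: eq_bigr => x _.
  rewrite /g scaler_prod coefZ prodrXr coefXn inE -(additive_character_sum chiP).
  have -> : (\sum_i (x 0%R i != 0%R))%N = hamming_weight x.
    by rewrite /hamming_weight -sum1_card [RHS]big_mkcond; apply: eq_bigr => i _;
      rewrite inE; case: (_ != _).
  by rewrite eq_sym; case: eqP; rewrite ?mulr1 ?mulr0.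
rewrite big_rV_distr; under eq_bigr do rewrite gE.
rewrite -coef_map map_kraw_poly /kraw_poly; congr (_`__).
rewrite (bigID (fun i => v 0 i != 0)) /=.
rewrite (eq_bigr (fun=> 1 - 'X)) => [|i ->] //.
rewrite [X in _ * X](eq_bigr (fun=> 1 + (q%:R - 1) * 'X)) => [|i /negbTE ->] //.
rewrite !prodr_const.
have cE : #|[pred i | v 0 i != 0]| = hamming_weight v.
  by rewrite /hamming_weight cardsE.
have cC : #|[pred i | ~~ (v 0 i != 0)]| = (n - hamming_weight v)%N.
  apply/eqP; rewrite -(eqn_add2l (hamming_weight v)) -cE subnKC.
    by rewrite (cardC [pred i | v 0 i != 0]) card_ord.
  by rewrite -[X in (_ <= X)%N]card_ord max_card.
by rewrite -cC -cE.
Qed.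

(** Each of the [q - 1] nonzero scalars contributes equally, since scaling [u] preserves its
    weight. *)
Lemma agreement0_slice (u : 'rV[F]_n) :
  agreement (fun _ : elt S => 0) u = (q - 1)%:Z * kraw q n w (hamming_weight u).
Proof.
have [chi chiP] := additive_character_exists F.
apply: (@intr_inj algC); rewrite (agreement_character chiP) exchange_big /=.
transitivity (\sum_(a : F | a != 0)
    ((kraw q n w (hamming_weight u))%:~R : algC)).
  apply: eq_bigr => a a0.
  rewrite (sum_elt S (fun x => chi (a * (0 - dot u x)))).
  rewrite -(hamming_weightZ u (_ : - a != 0)) ?oppr_eq0 //.
  rewrite -(sum_slice_character _ chiP); apply: eq_bigr => x _.
  by rewrite [dot (_ *: _) _]dotC dotZr [dot x u]dotC sub0r mulrN mulNr.
by rewrite sumr_const cardC1 rmorphM /= mulr_natl subn1.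
Qed.

End SliceTransform.

(** * Low moments and size of the agreement *)

Section AgreementMoments.

Variables (F : finFieldType) (n : nat) (S : {set 'rV[F]_n}).
Let q := #|F|.
Let q_gt1 : (1 < q)%N. Proof. exact: finNzRing_gt1. Qed.

Lemma sum_agreement0_exp k :
  \sum_u agreement (fun _ : elt S => 0) u ^+ k =
  (q ^ n)%:Z * #|test_tuples k S|%:Z.
Proof.
have q0 : (q - 1)%:Z != 0 by lia.
apply: (mulfI q0); rewrite sum_agreement_exp -/q mulrCA; congr (_ * _).
have -> : [set ax in test_tuples k S | test_accepts (fun=> 0) ax] =
    test_tuples k S.
  apply/setP => ax; rewrite inE /test_accepts; case: (_ \in _) => //=.
  by apply/eqP; rewrite big1 // => i _; rewrite mulr0.
by rewrite PoszM -subzn 1?ltnW // mulrBl mul1r.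
Qed.

Lemma sum_agreement_exp_le k (f : elt S -> F) :
  \sum_u agreement f u ^+ k <= \sum_u agreement (fun _ : elt S => 0) u ^+ k.
Proof.
have q0 : 0 < (q - 1)%:Z by lia.
rewrite -(ler_pM2l q0) sum_agreement0_exp sum_agreement_exp -/q mulrCA.
apply: ler_wpM2l => //; rewrite -subzn 1?ltnW // mulrBl mul1r PoszM.
rewrite lerB // ler_wpM2l // lez_nat subset_leq_card //.
by apply/fintype.subsetP => ax; rewrite inE => /andP[].
Qed.

(** In a relation [a_1 x_1 + a_2 x_2 = 0] with nonzero coefficients, [x_2] is determined by [a_1],
    [a_2] and [x_1]. *)
Lemma sum_agreement0_sqr :
  \sum_u agreement (fun _ : elt S => 0) u ^+ 2 <=
  (q ^ n * ((q - 1) ^ 2 * #|S|))%:Z.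
Proof.
rewrite sum_agreement0_exp PoszM ler_wpM2l // lez_nat.
pose U : {set F} := [set~ 0].
pose h (ax : {ffun 'I_2 -> F} * {ffun 'I_2 -> elt S}) :=
  (ax.1 ord0, ax.1 ord_max, ax.2 ord0).
have h_inj : {in test_tuples 2 S &, injective h}.
  move=> [a x] [b y]; rewrite !inE /= !big_ord_recl !big_ord0 !addr0.
  have -> : lift ord0 ord0 = ord_max :> 'I_2 by apply: val_inj.
  move=> /andP[/forallP a0 /eqP Ea] /andP[/forallP b0 /eqP Eb] [e1 e2 e3].
  have e4 : x ord_max = y ord_max.
    apply: val_inj; apply: (scalerI (a0 ord_max)).
    rewrite [in RHS]e2; move: Eb; rewrite -e1 -e3 -Ea.
    by move/addrI.
  congr pair; apply/ffunP => i.
    by case: (unliftP ord_max i) => [j|] ->; rewrite ?(ord1 j) //;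
      rewrite (_ : lift _ _ = ord0) //; apply: val_inj.
  by case: (unliftP ord_max i) => [j|] ->; rewrite ?(ord1 j) //;
    rewrite (_ : lift _ _ = ord0) //; apply: val_inj.
rewrite -(card_in_imset h_inj).
have -> : ((q - 1) ^ 2 * #|S| = #|finset.setX (finset.setX U U) [set: elt S]|)%N.
  by rewrite !cardsX cardsT card_elt cardsC1 -mulnn subn1.
apply: subset_leq_card; apply/fintype.subsetP => _ /imsetP[[a x] + ->].
by rewrite !inE /= => /andP[/forallP a0 _]; rewrite !a0.
Qed.

(** The test with one query has no tuples here, since [a x = 0] with [a] nonzero forces [x = 0]. The
    vanishing mean later makes the maximal agreement nonnegative. *)
Lemma sum_agreement (f : elt S -> F) : 0 \notin S ->
  \sum_u agreement f u = 0.
Proof.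
move=> S0; have q0 : (q - 1)%:Z != 0 by lia.
apply: (mulfI q0); rewrite mulr0.
have := sum_agreement_exp 1 f; under eq_bigr do rewrite expr1.
move=> ->.
have T0 : test_tuples 1 S = finset.set0.
  apply/setP => -[a x]; rewrite !inE /= big_ord1; apply/negP => /andP[/forallP a0].
  rewrite scaler_eq0 (negbTE (a0 _)) /= => /eqP x0.
  by case/negP: S0; rewrite -x0; exact: (valP (x ord0)).
rewrite T0 (_ : [set ax in _ | _] = finset.set0) ?cards0 ?muln0 ?subrr ?mulr0 //.
by apply/setP => ax; rewrite !inE.
Qed.

Lemma agreement_le (f : elt S -> F) u : `|agreement f u| <= ((q - 1) * #|S|)%:Z.
Proof.
rewrite /agreement -/q; set c := #|[set x | _]|.
have cS : (c <= #|S|)%N by rewrite -card_elt max_card.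
have : (q * c <= q * #|S|)%N by rewrite leq_mul2l cS orbT.
have : (#|S| <= (q - 1) * #|S|)%N by rewrite leq_pmull //; lia.
have : (q * #|S| = (q - 1) * #|S| + #|S|)%N.
  by rewrite mulnBl mul1n subnK // leq_pmull //; lia.
rewrite ler_norml; lia.
Qed.

Lemma agreement0_0 : agreement (fun _ : elt S => 0) 0 = ((q - 1) * #|S|)%:Z.
Proof.
rewrite /agreement (_ : [set x | _] = [set: elt S]) ?cardsT ?card_elt.
  by rewrite subzn ?leq_pmull -?mulnBl ?mulnBl ?mul1n //; lia.
by apply/setP => x; rewrite !inE /dot big1 ?eqxx // => i _; rewrite mxE mul0r.
Qed.

End AgreementMoments.

(** * The middle slice: trivial functionals, tail moments, parity *)

Section MidSlice.

Variables (F : finFieldType) (m : nat).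
Let q := #|F|.
Let n := (q * m)%N.
Let w := ((q - 1) * m)%N.
Let S := mid_slice F n.
Hypothesis m_gt0 : (0 < m)%N.

Let q_gt1 : (1 < q)%N. Proof. exact: finNzRing_gt1. Qed.
Let n_gt0 : (0 < n)%N. Proof. by rewrite muln_gt0 m_gt0 ltnW. Qed.

Lemma mid_slice_weight : ((q - 1) * n %/ q = w)%N.
Proof. by rewrite /n mulnCA mulKn // ltnW. Qed.

Lemma agreement0_mid_slice (u : 'rV[F]_n) :
  agreement (fun _ : elt S => 0) u = (q - 1)%:Z * kraw q n w (hamming_weight u).
Proof. by rewrite [LHS]agreement0_slice mid_slice_weight. Qed.

Lemma card_mid_slice : #|S|%:Z = kraw q n w 0.
Proof.
have q0 : (q - 1)%:Z != 0 by lia.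
apply: (mulfI q0); rewrite -PoszM -agreement0_0 agreement0_mid_slice.
by rewrite hamming_weight0.
Qed.

Lemma card_mid_slice_ge : (q ^ n <= n.+1 * #|S|)%N.
Proof.
have -> : #|S| = ('C(n, w) * (q - 1) ^ w)%N.
  by apply/eqP; rewrite -eqz_nat card_mid_slice kraw0 // ltnW.
exact: binomial_mode (ltnW q_gt1).
Qed.

Lemma card_mid_slice_gt0 : (0 < #|S|)%N.
Proof.
have := card_mid_slice_ge; case: #|S| => //; rewrite muln0 leqn0 expn_eq0.
by case: (q) q_gt1.
Qed.

Lemma mid_slice_notin0 : 0 \notin S.
Proof.
by rewrite inE hamming_weight0 mid_slice_weight eq_sym /w muln_eq0; lia.
Qed.

(* The functionals vanishing on the slice; for [q = 2] the sum of all
   coordinates is one of them, provided that the weight [w] is even. *)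
Definition trivial_functional (u : 'rV[F]_n) : bool :=
  (hamming_weight u == 0%N) || (q == 2%N) && (hamming_weight u == n).

Lemma agreement0_trivial (u : 'rV[F]_n) :
  (q == 2%N) ==> ~~ odd w -> trivial_functional u ->
  agreement (fun _ : elt S => 0) u = ((q - 1) * #|S|)%:Z.
Proof.
move=> qw; rewrite agreement0_mid_slice PoszM card_mid_slice.
case/orP => [/eqP -> //|/andP[q2 /eqP ->]]; congr (_ * _).
rewrite krawn kraw0 1?ltnW // (eqP q2) exp1n muln1 -signr_odd.
by move: qw; rewrite q2 /= => /negbTE ->; rewrite expr0 mul1r.
Qed.

Lemma agreement0_nontrivial (u : 'rV[F]_n) : ~~ trivial_functional u ->
  n%:Z ^+ 2 * agreement (fun _ : elt S => 0) u ^+ 2 <=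
  2%:Z * q%:Z ^+ 2 * ((q - 1) * #|S|)%:Z ^+ 2.
Proof.
rewrite negb_or => /andP[u0 un].
rewrite agreement0_mid_slice PoszM card_mid_slice !exprMn.
rewrite [X in X <= _]mulrCA [X in _ <= X]mulrCA.
apply: ler_wpM2l; first by rewrite sqr_ge0.
apply: kraw_bound => //; first by rewrite lt0n u0 hamming_weight_le.
have := hamming_weight_le u; move: un; rewrite negb_and.
by rewrite -/n; lia.
Qed.

(** Of the [j] factors, two use the pointwise decay [O(c / n)], [j - 4] the trivial bound [c], and
    the last two are summed by the second moment, at most [(n + 1) c^2]. The total is
    [2 q^2 (n + 1) c^j / n^2], and [n + 1 <= 2 n]. *)
Lemma sum_agreement0_nontrivial (j : nat) : (4 <= j)%N ->
  n%:Z * (\sum_(u | ~~ trivial_functional u)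
            `|agreement (fun _ : elt S => 0) u| ^+ j) <=
  4%:Z * q%:Z ^+ 2 * ((q - 1) * #|S|)%:Z ^+ j.
Proof.
move=> j4; set c := ((q - 1) * #|S|)%:Z.
pose g (u : 'rV[F]_n) := `|agreement (fun _ : elt S => 0) u|.
have g0 u : 0 <= g u by exact: normr_ge0.
have gc u : g u <= c by exact: agreement_le.
have c0 : 0 <= c by [].
have g2 u : g u ^+ 2 = agreement (fun _ : elt S => 0) u ^+ 2.
  by rewrite real_normK ?num_real.
have n0 : 0 < n%:Z by [].
have E u : ~~ trivial_functional u ->
    n%:Z ^+ 2 * g u ^+ j <= 2%:Z * q%:Z ^+ 2 * c ^+ (j - 2) * g u ^+ 2.
  move=> ut; have -> : j = (2 + (2 + (j - 4)))%N by lia.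
  rewrite addKn !exprD.
  have h1 := agreement0_nontrivial ut; rewrite -g2 -/c in h1.
  have h2 : g u ^+ (j - 4) <= c ^+ (j - 4) by rewrite lerXn2r ?nnegrE.
  have := ler_pM (mulr_ge0 (sqr_ge0 _) (sqr_ge0 _)) (exprn_ge0 _ (g0 u)) h1 h2.
  move=> /(ler_wpM2r (sqr_ge0 (g u))).
  by congr (_ <= _); ring.
have sum2 : \sum_(u | ~~ trivial_functional u) g u ^+ 2 <= n.+1%:Z * c ^+ 2.
  apply: (@le_trans _ _ (\sum_u agreement (fun _ : elt S => 0) u ^+ 2)).
    rewrite big_mkcond /=; apply: ler_sum => u _.
    by case: ifP => _; rewrite ?g2 // sqr_ge0.
  apply: le_trans (sum_agreement0_sqr S) _.
  rewrite -/q /c -!natz -natrX -natrM ler_nat expnMn.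
  have := leq_mul card_mid_slice_ge (leqnn ((q - 1) ^ 2 * #|S|)%N).
  by congr (_ <= _)%N; ring.
have : n%:Z * (n%:Z * \sum_(u | ~~ trivial_functional u) g u ^+ j) <=
    n%:Z * (4%:Z * q%:Z ^+ 2 * c ^+ j).
  rewrite mulrA -expr2 mulr_sumr.
  apply: le_trans (ler_sum _ E) _; rewrite -mulr_sumr.
  apply: le_trans (ler_wpM2l _ sum2) _.
    by rewrite !mulr_ge0 ?exprn_ge0 ?sqr_ge0.
  have -> : 2%:Z * q%:Z ^+ 2 * c ^+ (j - 2) * (n.+1%:Z * c ^+ 2) =
      (2%:Z * n.+1%:Z) * (q%:Z ^+ 2 * c ^+ j).
    have -> : c ^+ j = c ^+ (j - 2) * c ^+ 2 by rewrite -exprD subnK //; lia.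
    ring.
  have -> : n%:Z * (4%:Z * q%:Z ^+ 2 * c ^+ j) =
      (4%:Z * n%:Z) * (q%:Z ^+ 2 * c ^+ j) by ring.
  by rewrite ler_wpM2r ?mulr_ge0 ?exprn_ge0 ?sqr_ge0 //; lia.
by rewrite ler_pM2l.
Qed.

(** Over the field of two elements each vector of the slice has coordinate sum [w = 1], so a sum of
    an odd number of them has coordinate sum 1 and cannot vanish. *)
Lemma test_tuples_parity k : q = 2%N -> odd w -> odd k ->
  test_tuples k S = finset.set0.
Proof.
move=> q2 ow ok.
have F1 (a : F) : a != 0 -> a = 1.
  move=> a0; apply/eqP/negPn/negP => a1.
  have : (#|[set 0%R; 1%R; a]%SET| <= q)%N by exact: max_card.
  by rewrite finset.setUC cardsU1 cards2 !inE negb_or a0 a1 q2 eq_sym oner_eq0.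
have two0 : 2%:R = 0 :> F.
  apply/eqP/negPn/negP => /F1/eqP.
  by rewrite mulr2n -subr_eq0 addrK oner_eq0.
have nat2 i : i%:R = (odd i)%:R :> F.
  by rewrite -[in LHS](odd_double_half i) natrD -mul2n natrM two0 mul0r addr0.
pose e : 'rV[F]_n := const_mx 1.
have eS (x : elt S) : dot e (val x) = 1.
  have := valP x; rewrite inE mid_slice_weight => /eqP wx.
  transitivity (w%:R : F); last by rewrite nat2 ow.
  rewrite -wx /hamming_weight -sum1_card natr_sum /dot [RHS]big_mkcond /=.
  apply: eq_bigr => i _; rewrite mxE mul1r inE.
  by case: eqVneq => // /F1.
apply/setP => -[a x]; rewrite !inE /=; apply/negP => /andP[/forallP a0 /eqP E].
have := dot_sumr e (fun i : 'I_k => a i *: val (x i)); rewrite E.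
under eq_bigr => i _ do rewrite dotZr eS (F1 _ (a0 i)) mulr1.
rewrite sumr_const card_ord -[_ *+ k]/(k%:R) nat2 ok /dot big1 => [/eqP|i _].
  by rewrite eq_sym oner_eq0.
by rewrite !mxE mulr0.
Qed.

End MidSlice.

(** * Comparison of moments and choice of the functional *)

(** Up to a relative error [E], both moments of [g] count the indices in [T]. Evenness of [k] makes
    [G u ^+ k] nonnegative, so one factor [G u] can be replaced by [M]. *)
Lemma moment_ratio_bound (R : realFieldType) (I : finType) (T : pred I) (u0 : I)
    (G g : I -> R) (c M delta E : R) (k : nat) :
  0 < c -> ~~ odd k -> T u0 -> (forall u, T u -> g u = c) ->
  (forall j, (k <= j)%N -> \sum_(u | ~~ T u) `|g u| ^+ j <= E * c ^+ j) ->
  (forall u, G u <= M) -> 0 <= M <= c -> 0 <= delta <= 1 -> 0 <= E ->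
  \sum_u G u ^+ k <= \sum_u g u ^+ k ->
  delta * \sum_u g u ^+ k.+1 = \sum_u G u ^+ k.+1 ->
  delta <= M / c + 2 * E.
Proof.
move=> c0 ek Tu0 gT tail GM /andP[M0 Mc] /andP[d0 d1] E0 le_k eq_k.
pose D : R := #|T|%:R.
have D1 : 1 <= D by rewrite ler1n; apply/card_gt0P; exists u0.
have trivE j : \sum_(u | T u) g u ^+ j = D * c ^+ j.
  rewrite (eq_bigr (fun=> c ^+ j)) => [|u /gT -> //].
  by rewrite sumr_const mulr_natl.
have lo j : (k <= j)%N -> (D - E) * c ^+ j <= \sum_u g u ^+ j.
  move=> kj; rewrite (bigID T) /= trivE mulrBl lerD2l lerNl.
  apply: le_trans (tail j kj); rewrite -sumrN; apply: ler_sum => u _.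
  by rewrite -normrX -normrN ler_norm.
have hi j : (k <= j)%N -> \sum_u g u ^+ j <= (D + E) * c ^+ j.
  move=> kj; rewrite (bigID T) /= trivE mulrDl lerD2l.
  apply: le_trans (tail j kj); apply: ler_sum => u _.
  by rewrite -normrX ler_norm.
have mu01 : 0 <= M / c <= 1.
  by rewrite divr_ge0 ?(ltW c0) //= ler_pdivrMr // mul1r.
have main : delta * (D - E) <= M / c * (D + E).
  have ck : 0 < c ^+ k.+1 by rewrite exprn_gt0.
  rewrite -(ler_pM2r ck) -[delta * _ * _]mulrA.
  apply: le_trans (ler_wpM2l d0 (lo _ (leqnSn k))) _; rewrite eq_k.
  apply: (@le_trans _ _ (M * \sum_u G u ^+ k)).
    rewrite mulr_sumr; apply: ler_sum => u _; rewrite exprS.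
    by rewrite ler_wpM2r // exprn_even_ge0.
  apply: le_trans (ler_wpM2l M0 (le_trans le_k (hi _ (leqnn k)))) _.
  rewrite exprS le_eqVlt; apply/orP; left; apply/eqP.
  by field; rewrite gt_eqF.
(* With [mu = M / c], [main] reads [(delta - mu) D <= (delta + mu) E <= 2 E], and [D >= 1]. *)
case/andP: mu01 => mu0 mu1; nra.
Qed.

Lemma unif_pr_agreement (R : realType) (F : finFieldType) (n : nat)
    (S : {set 'rV[F]_n}) (f : elt S -> F) (u : 'rV[F]_n) : (0 < #|S|)%N ->
  unif_pr R [set: elt S]%SET (fun x => f x == dot u (val x)) =
  (1 + (agreement f u)%:~R / #|S|%:R) / #|F|%:R.
Proof.
move=> S0; have q0 : (0 < #|F|)%N by apply: ltnW; exact: finNzRing_gt1.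
rewrite /unif_pr cardsT card_elt /agreement rmorphB /= PoszM rmorphM /=.
rewrite (_ : [set x in [set: elt S] | _] = [set x | f x == dot u (val x)]%SET).
  by rewrite -!pmulrn; field; rewrite !pnatr_eq0 -!lt0n S0 q0.
by apply/setP => x; rewrite !inE.
Qed.

Lemma mid_slice_test_bound (R : realType) (F : finFieldType) (m k : nat)
    (f : elt (mid_slice F (#|F| * m)) -> F) (delta : R) :
  let q := #|F| in let n := (q * m)%N in
  (0 < m)%N -> odd k -> (5 <= k)%N ->
  test_pass_pr R k f = (1 + (q%:R - 1) * delta) / q%:R ->
  exists u : 'rV[F]_n,
    unif_pr R [set: elt (mid_slice F n)]%SET (fun x => f x == dot u (val x))
      >= (1 + (q%:R - 1) * delta) / q%:R - 8 * q%:R ^+ 2 / n%:R.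
Proof.
move=> q n m0 ok k5 pass.
have kE : k = k.-1.+1 by case: (k) k5.
have k4 : (4 <= k.-1)%N by case: (k) k5.
have q1 : (1 < q)%N by exact: finNzRing_gt1.
have n0 : (0 < n)%N by rewrite muln_gt0 m0 ltnW.
have q0R : 0 < q%:R :> R by rewrite ltr0n ltnW.
have q1R : 0 < q%:R - 1 :> R by rewrite subr_gt0 ltr1n.
have n0R : 0 < n%:R :> R by rewrite ltr0n.
pose S := mid_slice F n.
have S0 : (0 < #|S|)%N by exact: card_mid_slice_gt0.
have S0R : 0 < #|S|%:R :> R by rewrite ltr0n.
pose E : R := 4 * q%:R ^+ 2 / n%:R.
have E0 : 0 <= E by rewrite divr_ge0 ?mulr_ge0 ?sqr_ge0 ?ltW.
have EE : 8 * q%:R ^+ 2 / n%:R = 2 * E by rewrite /E; lra.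
rewrite EE.
pose T := test_tuples k S.
pose A := [set ax in T | test_accepts f ax].
(* Without tuples the pass probability is 0 by the convention on division, and any [u] works. *)
have [T0|T0] := posnP #|T|.
  exists 0; rewrite -pass /test_pass_pr /unif_pr -/S -/T T0 invr0 mulr0.
  by apply: (@le_trans _ _ 0); [lra|rewrite divr_ge0].
have T0R : 0 < #|T|%:R :> R by rewrite ltr0n.
(* A nonempty set of tuples excludes the parity obstruction, so every trivial functional does vanish
   on the slice. *)
have qw : (q == 2%N) ==> ~~ odd ((q - 1) * m).
  apply/implyP => /eqP q2; apply/negP => ow.
  by move: T0; rewrite /T /S (test_tuples_parity q2 ow ok) cards0.
pose G (u : 'rV[F]_n) := agreement f u.
pose g (u : 'rV[F]_n) := agreement (fun _ : elt S => 0) u.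
pose u := [arg max_(u > (0 : 'rV[F]_n)) G u]%O.
have Gmax v : G v <= G u by rewrite /u; case: arg_maxP => // i _; apply.
have Gu0 : 0 <= G u.
  rewrite leNgt; apply/negP => Gu.
  have : \sum_v G v = 0 by apply: sum_agreement; exact: mid_slice_notin0.
  apply/eqP; rewrite lt_eqF // (bigD1 0) //=.
  rewrite -[X in _ < X]addr0 ltr_leD //.
    by apply: le_lt_trans Gu.
  by apply: sumr_le0 => v _; apply: le_trans (ltW Gu).
exists u; rewrite unif_pr_agreement // -/q -/(G u).
pose c := ((q - 1) * #|S|)%:Z.
have cR : c%:~R = (q%:R - 1) * #|S|%:R :> R.
  by rewrite /c -pmulrn natrM natrB 1?ltnW.
have c0 : 0 < c%:~R :> R by rewrite cR mulr_gt0.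
have AT : (#|A| <= #|T|)%N.
  by apply: subset_leq_card; apply/fintype.subsetP => ax; rewrite inE => /andP[].
have Adelta : q%:R * #|A|%:R - #|T|%:R = (q%:R - 1) * delta * #|T|%:R :> R.
  move: pass; rewrite /test_pass_pr /unif_pr -/S -/T -/A.
  move/(congr1 (fun x => x * #|T|%:R * q%:R)).
  rewrite divfK ?gt_eqF // => H.
  by rewrite mulrC H; field; rewrite gt_eqF.
suff H : delta <= (G u)%:~R / c%:~R + 2 * E.
  have -> : (G u)%:~R / #|S|%:R = (q%:R - 1) * ((G u)%:~R / c%:~R) :> R.
    by rewrite cR; field; rewrite !gt_eqF.
  rewrite lerBlDr ler_pdivrMr // [X in _ <= X]mulrDl divfK ?gt_eqF //.
  have := ler_wpM2l (ltW q1R) H.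
  by nra.
(* A nonpositive [delta] is below the right side because the maximal agreement is nonnegative. *)
have [d0|d0] := leP delta 0.
  apply: le_trans d0 _; apply: addr_ge0; last by rewrite mulr_ge0.
  by rewrite divr_ge0 ?ler0z // ltW.
have d1 : delta <= 1.
  have AT' : #|A|%:R <= #|T|%:R :> R by rewrite ler_nat.
  rewrite -(ler_pM2r T0R) -(ler_pM2l q1R) mulrA -Adelta; nra.
have sumg : \sum_u (g u)%:~R ^+ k = q%:R ^+ n * #|T|%:R :> R.
  transitivity ((\sum_u g u ^+ k)%:~R : R).
    by rewrite rmorph_sum /=; apply: eq_bigr => v _; rewrite rmorphXn.
  by rewrite (sum_agreement0_exp S k) rmorphM /= -!pmulrn natrX.
have sumG : (q%:R - 1) * \sum_u (G u)%:~R ^+ k =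
    q%:R ^+ n * (q%:R * #|A|%:R - #|T|%:R) :> R.
  have := congr1 (intr : int -> R) (sum_agreement_exp k f).
  rewrite !rmorphM /= rmorphB /= rmorph_sum /= -/A -/T -!pmulrn natrX natrM.
  rewrite natrB 1?ltnW // => <-; congr (_ * _).
  by apply: eq_bigr => v _; rewrite rmorphXn.
apply: (@moment_ratio_bound R _ (@trivial_functional F m) 0 (fun v => (G v)%:~R)
  (fun v => (g v)%:~R) c%:~R (G u)%:~R delta E k.-1) => //.
- by move: ok; rewrite {1}kE.
- by rewrite /trivial_functional hamming_weight0.
- by move=> v tv; rewrite /g agreement0_trivial.
- move=> j kj; have j4 := leq_trans k4 kj.
  have := sum_agreement0_nontrivial F m0 j4.
  rewrite -(ler_int R) !rmorphM /= !rmorphXn /= rmorph_sum /=.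
  move=> H; rewrite /E mulrAC ler_pdivlMr // mulrC; move: H.
  congr (_ * _ <= _); first by rewrite -!pmulrn -natrM.
  apply: eq_bigr => v _.
  by rewrite rmorphXn /= intr_norm.
- by move=> v; rewrite ler_int.
- rewrite ler0z Gu0 ler_int /=; exact: le_trans (ler_norm _) (agreement_le _ _).
- by rewrite ltW.
- have := sum_agreement_exp_le k.-1 f.
  rewrite -(ler_int R) !rmorph_sum /=.
  by congr (_ <= _); apply: eq_bigr => v _; rewrite rmorphXn.
rewrite -kE sumg; apply: (mulfI (lt0r_neq0 q1R)); rewrite sumG Adelta; ring.
Qed.

Local Open Scope classical_set_scope.

Theorem theorem4p1 (R : realType) (q k : nat)
    (hq : exists p m : nat, [/\ prime p, (0 < m)%N & q = (p ^ m)%N])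
    (hk : odd k) (hk5 : (5 <= k)%N) :
  exists eps : nat -> R,
    (eps n @[n --> \oo] --> (0 : R)) /\
    forall (F : finFieldType) (n : nat) (f : elt (mid_slice F n) -> F) (delta : R),
      #|F| = q -> (0 < n)%N -> (q %| n)%N ->
      test_pass_pr R k f = (1 + (q%:R - 1) * delta) / q%:R ->
      exists u : 'rV[F]_n,
        unif_pr R [set: elt (mid_slice F n)]%SET (fun x => f x == dot u (val x))
          >= (1 + (q%:R - 1) * delta) / q%:R - eps n.
Proof.
(* [harmonic n] is [1 / (n + 1)]; as [1 / n <= 2 / (n + 1)] for positive [n], the error [8 q^2 / n]
   fits under this sequence. *)
exists (fun n => 16 * q%:R ^+ 2 * harmonic n); split.
  rewrite -[X in _ --> X](mulr0 (16 * q%:R ^+ 2 : R)).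
  by apply: cvgMr; exact: cvg_harmonic.
move=> F n f delta Fq n0 /dvdnP[m nE] pass; subst q.
have {}nE : n = (#|F| * m)%N by rewrite nE mulnC.
subst n; have m0 : (0 < m)%N by move: n0; rewrite muln_gt0 => /andP[].
have [u uP] := mid_slice_test_bound m0 hk hk5 pass.
exists u; apply: le_trans uP; rewrite lerB //.
have -> : 16 * #|F|%:R ^+ 2 * harmonic (#|F| * m) =
    8 * #|F|%:R ^+ 2 * (2 * harmonic (#|F| * m)) :> R by ring.
apply: ler_wpM2l; first by rewrite mulr_ge0 ?sqr_ge0.
rewrite /harmonic /= ler_pdivlMr ?ltr0n // mulrC ler_pdivrMr ?ltr0n //.
by rewrite -natrM ler_nat mul2n -addnn -addn1 leq_add2l.
Qed.
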